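(* Let $\sigma=(s_{i,j})_{1\le i,j\le n}$ be a shift matrix which is upper triangular, i.e. $s_{i,j}=0$ for $i>j$. Then ${}^\sigma C_n(u)=C_n(u)$ as elements of $Y_n[[u^{-1}]]$. In particular, the coefficients of ${}^\sigma C_n(u)$ belong to the center of $Y_n(\sigma)$.
   Context: $F$ is an algebraically closed field of characteristic zero. The Yangian $Y_n$ is the associative $F$-algebra with generators $T_{i,j}^{(r)}$ ($1\le i,j\le n$, $r\ge1$) and relations $[T_{i,j}^{(r)},T_{k,l}^{(s)}]=\sum_{t=0}^{\min(r,s)-1}\big(T_{k,j}^{(t)}T_{i,l}^{(r+s-1-t)}-T_{k,j}^{(r+s-1-t)}T_{i,l}^{(t)}\big)$, where $T_{i,j}^{(0)}:=\delta_{i,j}$. Let $T_{i,j}(u)=\sum_{r\ge0}T_{i,j}^{(r)}u^{-r}\in Y_n[[u^{-1}]]$ and let $T(u)$ be the matrix with these entries. It has a unique Gauss factorization $T(u)=F(u)D(u)E(u)$ with $D(u)$ diagonal with entries $D_i(u)=\sum_{r\ge0}D_i^{(r)}u^{-r}$ ($D_i^{(0)}=1$), $E(u)$ upper unitriangular with $(i,j)$-entry $E_{i,j}(u)=\sum_{r\ge1}E_{i,j}^{(r)}u^{-r}$ for $i<j$, and $F(u)$ lower unitriangular with $(j,i)$-entry $F_{i,j}(u)=\sum_{r\ge1}F_{i,j}^{(r)}u^{-r}$ for $i<j$. A shift matrix is an $n\times n$ matrix $\sigma=(s_{i,j})$ of non-negative integers with $s_{i,j}+s_{j,k}=s_{i,k}$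 whenever $|i-j|+|j-k|=|i-k|$. The shifted Yangian $Y_n(\sigma)$ is the subalgebra of $Y_n$ generated by $D_i^{(r)}$ ($1\le i\le n$, $r>0$), $E_i^{(r)}:=E_{i,i+1}^{(r)}$ ($1\le i<n$, $r>s_{i,i+1}$) and $F_i^{(r)}:=F_{i,i+1}^{(r)}$ ($1\le i<n$, $r>s_{i+1,i}$). For $1\le i<j\le n$ define recursively ${}^\sigma E_{i,i+1}^{(r)}:=E_i^{(r)}$, ${}^\sigma E_{i,j}^{(r)}:=[{}^\sigma E_{i,j-1}^{(r-s_{j-1,j})},E_{j-1}^{(s_{j-1,j}+1)}]$ for $r>s_{i,j}$, and ${}^\sigma F_{i,i+1}^{(r)}:=F_i^{(r)}$, ${}^\sigma F_{i,j}^{(r)}:=[F_{j-1}^{(s_{j,j-1}+1)},{}^\sigma F_{i,j-1}^{(r-s_{j,j-1})}]$ for $r>s_{j,i}$; set ${}^\sigma E_{i,j}(u)=\sum_{r>s_{i,j}}{}^\sigma E_{i,j}^{(r)}u^{-r}$, ${}^\sigma F_{i,j}(u)=\sum_{r>s_{j,i}}{}^\sigma F_{i,j}^{(r)}u^{-r}$, ${}^\sigma E_{i,i}(u)={}^\sigma F_{i,i}(u)=1$, and ${}^\sigma T_{i,j}(u):=\sum_{k=1}^{\min(i,j)}{}^\sigma F_{k,i}(u)D_k(u){}^\sigma E_{k,j}(u)$. For an $n\times n$ matrix $A=(a_{i,j})$ over an associative algebra, $\mathrm{cdet}A:=\sum_{w\in S_n}\mathrm{sgn}(w)a_{w1,1}a_{w2,2}\cdots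 a_{wn,n}$. Define $C_n(u):=\mathrm{cdet}\big(T_{i,j}(u-j+1)\big)_{1\le i,j\le n}$ and ${}^\sigma C_n(u):=\mathrm{cdet}\big({}^\sigma T_{i,j}(u-j+1)\big)_{1\le i,j\le n}$, where series in $u-j+1$ are re-expanded as power series in $u^{-1}$. *)

(* Defs.v *)
From HB Require Import structures.
From mathcomp Require Import all_boot all_order all_algebra all_fingroup.
Set Implicit Arguments. Unset Strict Implicit. Unset Printing Implicit Defensive.
Import GRing.Theory.
Local Open Scope ring_scope.

(* Formal power series in u^{-1} over a (noncommutative) ring A are
   represented by their coefficient sequences: f : nat -> A, f r being the
   coefficient of u^{-r}.  All matrix indices are 0-based naturals
   (paper index i corresponds to i-1 here). *)

Section Series.
Variable A : ringType.

Definition ps1 : nat -> A := fun m => (m == 0%N)%:R.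

Definition ps_mul (f g : nat -> A) : nat -> A :=
  fun m => \sum_(k < m.+1) f k * g (m - k)%N.

(* f(u - c) re-expanded in u^{-1}:  (u-c)^{-r} = sum_k C(r+k-1,k) c^k u^{-r-k} *)
Definition ps_shift (c : nat) (f : nat -> A) : nat -> A :=
  fun m => \sum_(r < m.+1) f r * ('C(m.-1, m - r) * c ^ (m - r))%N%:R.

Definition comm (x y : A) : A := x * y - y * x.

Definition cdet (n : nat) (M : nat -> nat -> nat -> A) : nat -> A :=
  fun m => \sum_(w : 'S_n)
     (-1) ^+ w * foldr (fun j acc => ps_mul (M (w j : nat) (j : nat)) acc) ps1
                        (enum 'I_n) m.

Definition Tser (T : nat -> nat -> nat -> A) (i j : nat) : nat -> A :=
  fun r => if r is 0 then (i == j)%:R else T i j r.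

Definition yangian_rel (n : nat) (T : nat -> nat -> nat -> A) : Prop :=
  forall i j k l r s, (i < n)%N -> (j < n)%N -> (k < n)%N -> (l < n)%N ->
    (0 < r)%N -> (0 < s)%N ->
    comm (T i j r) (T k l s) =
    \sum_(t < minn r s)
      (Tser T k j t * Tser T i l (r + s - 1 - t)%N
       - Tser T k j (r + s - 1 - t)%N * Tser T i l t).

Definition tri_entry (X : nat -> nat -> nat -> A) (k j : nat) : nat -> A :=
  if k == j then ps1 else X k j.

(* T(u) = F(u) D(u) E(u): E k j = E_{k,j}(u), F k j = F_{k,j}(u) for k < j
   (F_{k,j}(u) being the (j,k)-entry of F(u)), D i = D_i(u). *)
Definition gauss_factorization (n : nat) (T : nat -> nat -> nat -> A)
    (D : nat -> nat -> A) (E F : nat -> nat -> nat -> A) : Prop :=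
  (forall i, (i < n)%N -> D i 0%N = 1) /\
  (forall i j, (i < j)%N -> (j < n)%N -> E i j 0%N = 0 /\ F i j 0%N = 0) /\
  (forall i j m, (i < n)%N -> (j < n)%N ->
     Tser T i j m =
     \sum_(k < n | (k <= i)%N && (k <= j)%N)
        ps_mul (ps_mul (tri_entry F k i) (D k)) (tri_entry E k j) m).

Definition C_n (n : nat) (T : nat -> nat -> nat -> A) : nat -> A :=
  cdet n (fun i j => ps_shift j (Tser T i j)).

Section Shifted.
Variables (n : nat) (sg : nat -> nat -> nat).
Variables (D : nat -> nat -> A) (E F : nat -> nat -> nat -> A).

Fixpoint sigE (i j : nat) {struct j} : nat -> A := fun r =>
  match j with
  | 0 => 0
  | j'.+1 =>
      if j' == i then E i j r
      else if (i < j')%N then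
        comm (sigE i j' (r - sg j' j)%N) (E j' j (sg j' j).+1)
      else 0
  end.

Fixpoint sigF (i j : nat) {struct j} : nat -> A := fun r =>
  match j with
  | 0 => 0
  | j'.+1 =>
      if j' == i then F i j r
      else if (i < j')%N then
        comm (F j' j (sg j j').+1) (sigF i j' (r - sg j j')%N)
      else 0
  end.

Definition sigEser (i j : nat) : nat -> A :=
  if i == j then ps1 else fun r => if (sg i j < r)%N then sigE i j r else 0.

Definition sigFser (i j : nat) : nat -> A :=
  if i == j then ps1 else fun r => if (sg j i < r)%N then sigF i j r else 0.

Definition sigT (i j : nat) : nat -> A := fun m =>
  \sum_(k < n | (k <= i)%N && (k <= j)%N)
     ps_mul (ps_mul (sigFser k i) (D k)) (sigEser k j) m.

Definition sigma_C_n : nat -> A := cdet n (fun i j => ps_shift j (sigT i j)).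

Definition shifted_gen (x : A) : Prop :=
  (exists i r, (i < n)%N /\ (0 < r)%N /\ x = D i r) \/
  (exists i r, (i.+1 < n)%N /\ (sg i i.+1 < r)%N /\ x = E i i.+1 r) \/
  (exists i r, (i.+1 < n)%N /\ (sg i.+1 i < r)%N /\ x = F i i.+1 r).

End Shifted.
End Series.

Definition natdist (a b : nat) : nat := (a - b) + (b - a).

Definition is_shift_matrix (n : nat) (sg : nat -> nat -> nat) : Prop :=
  forall i j k, (i < n)%N -> (j < n)%N -> (k < n)%N ->
    (natdist i j + natdist j k)%N = natdist i k ->
    sg i k = (sg i j + sg j k)%N.

Inductive gen_subalg (K : fieldType) (A : algType K) (S : A -> Prop) : A -> Prop :=
  | gsa_gen x : S x -> gen_subalg S x
  | gsa_one : gen_subalg S 1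
  | gsa_scale (a : K) x : gen_subalg S x -> gen_subalg S (a *: x)
  | gsa_add x y : gen_subalg S x -> gen_subalg S y -> gen_subalg S (x + y)
  | gsa_mul x y : gen_subalg S x -> gen_subalg S y -> gen_subalg S (x * y).

(* Main.v *)
Require Import Defs.
From HB Require Import structures.
From mathcomp Require Import all_boot all_order all_algebra all_fingroup.
From mathcomp Require Import boolp zify.
Set Implicit Arguments. Unset Strict Implicit. Unset Printing Implicit Defensive.
Import GRing.Theory.
Local Open Scope ring_scope.

(** The relations of the Yangian make the column determinant of T with prescribed
    columns c_1, ..., c_n, i.e. the alternating sum of products of the
    T_{w j, c_j}(u - j + 1), skew-symmetric in the c_j.  Since [sg] is upper
    triangular, the shifted F coincides with F, because
    F_{i,j}^(r) = [F_{j-1}^(1), F_{i,j-1}^(r)].  Hence the shifted T equals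
    T E^{-1} E' with E' upper unitriangular: its j-th column is the j-th column of T
    plus right multiples of earlier columns, and these contribute nothing to the
    column determinant.

    For centrality, set s_c = T(v - c).  The commutator of t = T(u) with the
    antisymmetrized product of s_0, ..., s_{m-1} is determined by induction on m;
    for m = n it gives (u - v - 1)[t_{k,l}(u), C_n(v)] = 0.  Multiplied by
    x y, where x = u^{-1} and y = v^{-1}, the factor u - v + c becomes
    y - x + c x y, which is not a zero divisor in A[[y]][[x]].  Finally, whatever
    commutes with T commutes with its Gauss factors. *)

(** * Power series over a noncommutative ring *)

(** A separate name for [nat -> A], on which convolution becomes the ring multiplication. *)
Definition pseries (A : nzRingType) : Type := nat -> A.

Section PowerSeries.
Variable A : nzRingType.
Implicit Types f g h : nat -> A.

(** Coefficients up to m of a product only see the truncations at degree m, so associativity of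
    [ps_mul] is inherited from polynomials. *)
Let trunc m f : {poly A} := \poly_(i < m.+1) f i.

Let ps_mul_trunc m k f g : (k <= m)%N ->
  ps_mul f g k = (trunc m f * trunc m g)`_k.
Proof.
move=> le_km; rewrite coefM; apply: eq_bigr => i _.
have le_ik : (i <= k)%N by rewrite -ltnS.
by rewrite !coef_poly !ltnS (leq_trans le_ik) // (leq_trans (leq_subr _ _)).
Qed.

Let ps_mulA : associative (@ps_mul A).
Proof.
move=> f g h; apply/funext => m.
transitivity ((trunc m f * (trunc m g * trunc m h))`_m).
  rewrite coefM; apply: eq_bigr => i _.
  by rewrite coef_poly ltn_ord (@ps_mul_trunc m) // leq_subr.
rewrite mulrA coefM; apply: eq_bigr => i _.
by rewrite coef_poly ltnS leq_subr (@ps_mul_trunc m) // -ltnS.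
Qed.

Let ps_mul1l : left_id (@ps1 A) (@ps_mul A).
Proof.
move=> f; apply/funext => m; rewrite /ps_mul big_ord_recl mul1r subn0.
by rewrite big1 ?addr0 // => i _; rewrite mul0r.
Qed.

Let ps_mul1r : right_id (@ps1 A) (@ps_mul A).
Proof.
move=> f; apply/funext => m; rewrite /ps_mul big_ord_recr /= subnn mulr1.
rewrite big1 ?add0r // => i _; rewrite /ps1 subn_eq0 leqNgt ltn_ord mulr0 //.
Qed.

HB.instance Definition _ := gen_eqMixin (pseries A).
HB.instance Definition _ := gen_choiceMixin (pseries A).

Program Definition ps_zmodMixin :=
  @GRing.isZmodule.Build (pseries A) (fun _ => 0) (fun f m => - f m)
    (fun f g m => f m + g m) _ _ _ _.
Next Obligation. by move=> f g h; apply/funext => m; rewrite addrA. Qed.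
Next Obligation. by move=> f g; apply/funext => m; rewrite addrC. Qed.
Next Obligation. by move=> f; apply/funext => m; rewrite add0r. Qed.
Next Obligation. by move=> f; apply/funext => m; rewrite addNr. Qed.
HB.instance Definition _ := ps_zmodMixin.

Program Definition ps_ringMixin :=
  @GRing.Zmodule_isNzRing.Build (pseries A) (@ps1 A) (@ps_mul A)
    ps_mulA ps_mul1l ps_mul1r _ _ _.
Next Obligation.
move=> f g h; apply/funext => m; rewrite /ps_mul.
by rewrite [RHS]/GRing.add /= -big_split; apply: eq_bigr => i _; rewrite mulrDl.
Qed.
Next Obligation.
move=> f g h; apply/funext => m; rewrite /ps_mul.
by rewrite [RHS]/GRing.add /= -big_split; apply: eq_bigr => i _; rewrite mulrDr.
Qed.
Next Obligation.
by apply/negP => /eqP /(congr1 (@^~ 0%N)) /eqP; rewrite /ps1 /= oner_eq0.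
Qed.
HB.instance Definition _ := ps_ringMixin.

End PowerSeries.

Section PowerSeriesTheory.
Variable A : nzRingType.
Implicit Types f g h : pseries A.

Lemma psD f g m : (f + g) m = f m + g m. Proof. by []. Qed.
Lemma psN f m : (- f) m = - f m. Proof. by []. Qed.
Lemma psM f g m : (f * g) m = \sum_(k < m.+1) f k * g (m - k)%N.
Proof. by []. Qed.
Lemma ps_sum (I : Type) (r : seq I) (P : pred I) (F : I -> pseries A) m :
  (\sum_(i <- r | P i) F i) m = \sum_(i <- r | P i) F i m.
Proof. by elim/big_rec2: _ => // i x y _ <-. Qed.

Lemma psMn f c m : (f *+ c) m = f m *+ c.
Proof. by elim: c => // c IHc; rewrite !mulrS psD IHc. Qed.

Definition psC (a : A) : pseries A := fun m => if m is 0 then a else 0.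

(** The variable u^{-1} itself. *)
Definition psX : pseries A := fun m => (m == 1%N)%:R.

Lemma psCM a f m : (psC a * f) m = a * f m.
Proof.
rewrite psM big_ord_recl subn0 big1 ?addr0 // => i _; exact: mul0r.
Qed.

Lemma psMC a f m : (f * psC a) m = f m * a.
Proof.
rewrite psM big_ord_recr /= subnn big1 ?add0r // => i _.
by rewrite /psC; case: (m - i)%N (subn_gt0 i m) => [|k _]; rewrite ?ltn_ord ?mulr0.
Qed.

Lemma psCD a b : psC (a + b) = psC a + psC b.
Proof. by apply/funext => -[|m]; rewrite psD //= addr0. Qed.

Lemma psCN a : psC (- a) = - psC a.
Proof. by apply/funext => -[|m]; rewrite psN //= oppr0. Qed.

Lemma psCMM a b : psC (a * b) = psC a * psC b.
Proof. by apply/funext => -[|m]; rewrite psCM //= mulr0. Qed.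

Lemma psXM f m : (psX * f) m = if m is k.+1 then f k else 0.
Proof.
case: m => [|m]; first by rewrite psM big_ord1 mul0r.
rewrite psM !big_ord_recl mul0r add0r mul1r subSS subn0 big1 ?addr0 // => i _.
by rewrite mul0r.
Qed.

Lemma psMX f m : (f * psX) m = if m is k.+1 then f k else 0.
Proof.
case: m => [|m]; first by rewrite psM big_ord1 mulr0.
rewrite psM !big_ord_recr /= subnn mulr0 addr0 subSnn mulr1 big1 ?add0r // => i _.
by rewrite /psX subSn ?(ltnW (ltn_ord i)) // eqSS subn_eq0 leqNgt ltn_ord mulr0.
Qed.

Lemma psX_comm f : psX * f = f * psX.
Proof. by apply/funext => m; rewrite psXM psMX. Qed.

(** Coefficient m of [f * g] is [g m] plus terms in lower coefficients of [g], which vanish by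
    induction. *)
Lemma ps_lcancel f g : f 0%N = 1 -> f * g = 0 -> g = 0.
Proof.
move=> f0 fg0; apply/funext; elim/ltn_ind => m IHm.
have /(congr1 (@^~ m)) := fg0; rewrite /= psM big_ord_recl subn0 f0 mul1r.
rewrite big1 ?addr0 // => i _; rewrite IHm ?mulr0 //.
by rewrite ltn_subrL (leq_ltn_trans _ (ltn_ord i)).
Qed.

Lemma ps_rcancel f g : g 0%N = 1 -> f * g = 0 -> f = 0.
Proof.
move=> g0 fg0; apply/funext; elim/ltn_ind => m IHm.
have /(congr1 (@^~ m)) := fg0; rewrite /= psM big_ord_recr /= subnn g0 mulr1.
by rewrite big1 ?add0r // => i _; rewrite IHm ?mul0r.
Qed.

End PowerSeriesTheory.

(** * The substitution of u - c for u *)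

Section Shift.
Variables (A : nzRingType) (c : nat).
Implicit Types f g : nat -> A.

(** Each coefficient of a shifted series is an integral combination of coefficients of the series,
    so additive maps pass through. Used for commutators with, and products by, a fixed element. *)
Lemma ps_shift_morph (A' : nzRingType) (phi : A -> A') f m :
    (forall x y, phi (x + y) = phi x + phi y) ->
  phi (ps_shift c f m) = ps_shift c (phi \o f) m.
Proof.
move=> phiD; have phi0 : phi 0 = 0.
  by apply: (addrI (phi 0)); rewrite -phiD !addr0.
rewrite /ps_shift (big_morph phi phiD phi0); apply: eq_bigr => i _ /=.
rewrite !mulr_natr; elim: (_ * _)%N => // k IHk; by rewrite !mulrS phiD IHk.
Qed.

Lemma ps_shiftD f g m :
  ps_shift c (fun k => f k + g k) m = ps_shift c f m + ps_shift c g m.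
Proof. by rewrite -big_split; apply: eq_bigr => i _; rewrite mulrDl. Qed.

Lemma ps_shiftN f m : ps_shift c (fun k => - f k) m = - ps_shift c f m.
Proof. by rewrite -sumrN; apply: eq_bigr => i _; rewrite mulNr. Qed.

Lemma ps_shift0 f : ps_shift c f 0%N = f 0%N.
Proof. by rewrite /ps_shift big_ord1 subnn bin0 expn0 muln1 mulr1. Qed.

(* (1 - c y) sigma(y f') = y sigma(f') for the substitution sigma : y |-> y/(1 - c y),
   where f' is the tail of f. *)
Lemma ps_shiftS f m : f 0%N = 0 ->
  ps_shift c f m.+1 = ps_shift c f m *+ c + ps_shift c (fun k => f k.+1) m.
Proof.
move=> f0; rewrite /ps_shift big_ord_recl f0 mul0r add0r.
case: m => [|m].
  rewrite !big_ord1 f0 mul0r mul0rn add0r /= subnn.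
  by rewrite /bump /= !bin0 !expn0.
rewrite [X in _ = X *+ c + _]big_ord_recl f0 mul0r add0r.
rewrite [LHS]big_ord_recr [X in _ = _ + X]big_ord_recr /=.
rewrite addrA -sumrMnl -big_split; congr (_ + _); last first.
  by rewrite /bump /= add1n !subnn !bin0.
apply: eq_bigr => i _ /=.
rewrite /bump /= !add1n !subSS -mulrnAr -mulrDr; congr (_ * _).
rewrite -mulrnA -natrD; congr _%:R.
rewrite subSn; last by rewrite -ltnS (leq_trans (ltn_ord i)).
rewrite binS mulnDl addnC expnS; congr (_ + _)%N.
by rewrite (mulnC c) mulnA.
Qed.

(** Induction on the coefficient: the constant term of [f] factors out, and [ps_shiftS] reduces
    coefficient m+1 of the rest to coefficient m of two products. *)
Lemma ps_shiftM f g : ps_shift c (ps_mul f g) = ps_mul (ps_shift c f) (ps_shift c g).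
Proof.
apply/funext => m; elim: m f => [|m IHm] f.
  by rewrite ps_shift0 /ps_mul !big_ord1 !ps_shift0.
pose f1 k := if k is 0 then 0 else f k.
have fE : f = psC (f 0%N) + f1 :> pseries A.
  by apply/funext => -[|k]; rewrite psD /= ?addr0 ?add0r.
have f1M0 : ps_mul f1 g 0%N = 0 by rewrite /ps_mul big_ord1 mul0r.
have f1MS k : ps_mul f1 g k.+1 = ps_mul (fun k => f k.+1) g k.
  by rewrite /ps_mul big_ord_recl mul0r add0r; apply: eq_bigr => i _; rewrite subSS.
have shC (a : A) (h : nat -> A) k : ps_shift c (ps_mul (psC a) h) k = a * ps_shift c h k.
  rewrite (ps_shift_morph (phi := fun x => a * x)); last exact: mulrDr.
  by congr (ps_shift c _ k); apply/funext => j; apply: (psCM a (h : pseries A) j).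
have shE (h : nat -> A) k : ps_shift c h k =
    ps_shift c (psC (h 0%N)) k + ps_shift c (fun j => if j is 0 then 0 else h j) k.
  rewrite -ps_shiftD; congr (ps_shift c _ k).
  by apply/funext => -[|j]; rewrite /= ?addr0 ?add0r.
have shK (a : A) : ps_shift c (psC a) = psC a.
  apply/funext => k; rewrite /ps_shift big_ord_recl big1 => [|j _]; last exact: mul0r.
  by case: k => [|k]; rewrite addr0 /= subn0 ?mulr1 // bin_small // mulr0.
have -> : ps_mul f g = fun k => ps_mul (psC (f 0%N)) g k + ps_mul f1 g k.
  by apply/funext => k; rewrite [in LHS]fE -[LHS]/((_ * (g : pseries A)) k) mulrDl.
rewrite ps_shiftD shC (ps_shiftS _ f1M0).
have -> : (fun k => ps_mul f1 g k.+1) = ps_mul (fun k => f k.+1) g by exact/funext.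
rewrite !IHm.
rewrite [RHS]/ps_mul big_ord_recl ps_shift0 subn0; congr (_ + _).
rewrite /ps_mul -sumrMnl -big_split; apply: eq_bigr => j _ /=.
rewrite subSS (shE f j.+1) shK add0r ps_shiftS // mulrDl mulrnAl //.
Qed.
End Shift.

(** * Transpositions and permutations of natural indices *)

Definition swap (i j k : nat) : nat :=
  if k == i then j else if k == j then i else k.

Definition upd (f : nat -> nat) (c x k : nat) : nat := if k == c then x else f k.

Lemma swapL i j : swap i j i = j. Proof. by rewrite /swap eqxx. Qed.
Lemma swapR i j : swap i j j = i.
Proof. by rewrite /swap eqxx; case: eqP. Qed.
Lemma swapD i j k : k != i -> k != j -> swap i j k = k.
Proof. by rewrite /swap => /negPf-> /negPf->. Qed.
(** Extended by the identity beyond n, so that permutations act on plain natural indices. *)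
Definition perm_nat n (w : 'S_n) (j : nat) : nat :=
  if insub j is Some i then val (w i) else j.

Lemma perm_nat_ord n (w : 'S_n) (i : 'I_n) : perm_nat w i = w i.
Proof. by rewrite /perm_nat valK. Qed.

Lemma perm_nat_tperm n (w : 'S_n) (i j : 'I_n) :
  perm_nat (tperm i j * w)%g = perm_nat w \o swap i j.
Proof.
apply/funext => k /=; case: (ltnP k n) => [kn|nk]; last first.
  have nko (o : 'I_n) : k != o by rewrite gtn_eqF // (leq_trans (ltn_ord o)).
  by rewrite swapD // /perm_nat insubF // ltnNge nk.
have -> : k = Ordinal kn by [].
have -> : swap i j (Ordinal kn) = tperm i j (Ordinal kn).
  by case: tpermP => [->|->|/eqP ni /eqP nj]; rewrite ?swapL ?swapR ?swapD.
by rewrite !perm_nat_ord permM.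
Qed.

(** * Alternating sums *)

Section Alternation.
Variables (B : nzRingType) (n : nat).
Hypothesis B2 : forall z : B, z + z = 0 -> z = 0.
Implicit Types (G H : (nat -> nat) -> B) (f b : nat -> nat).

Definition Alt G : B := \sum_(w : 'S_n) (-1) ^+ w * G (perm_nat w).

Lemma eq_Alt G H : (forall f, G f = H f) -> Alt G = Alt H.
Proof. by move=> eqGH; apply: eq_bigr => w _; rewrite eqGH. Qed.

Lemma Alt0 G : (forall f, G f = 0) -> Alt G = 0.
Proof. by move=> G0; rewrite /Alt big1 // => w _; rewrite G0 mulr0. Qed.

Lemma AltD G H : Alt (fun f => G f + H f) = Alt G + Alt H.
Proof. by rewrite -big_split; apply: eq_bigr => w _; rewrite mulrDr. Qed.

Lemma AltN G : Alt (fun f => - G f) = - Alt G.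
Proof. by rewrite -sumrN; apply: eq_bigr => w _; rewrite mulrN. Qed.

Lemma AltB G H : Alt (fun f => G f - H f) = Alt G - Alt H.
Proof. by rewrite AltD AltN. Qed.

Lemma Alt_sum m (G : nat -> (nat -> nat) -> B) :
  Alt (fun f => \sum_(c < m) G c f) = \sum_(c < m) Alt (G c).
Proof. by rewrite exchange_big; apply: eq_bigr => w _; rewrite mulr_sumr. Qed.

Lemma AltMl x G : Alt (fun f => x * G f) = x * Alt G.
Proof.
rewrite mulr_sumr; apply: eq_bigr => w _.
by rewrite !mulrA (commr_sign x).
Qed.

Lemma AltMr x G : Alt (fun f => G f * x) = Alt G * x.
Proof. by rewrite mulr_suml; apply: eq_bigr => w _; rewrite mulrA. Qed.

Lemma Alt_swap i j G : (i < n)%N -> (j < n)%N -> i != j ->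
  Alt (fun f => G (f \o swap i j)) = - Alt G.
Proof.
move=> lti ltj neij; pose oi := Ordinal lti; pose oj := Ordinal ltj.
rewrite -sumrN (reindex_inj (mulgI (tperm oi oj))) /=.
apply: eq_bigr => w _; rewrite perm_nat_tperm odd_permM odd_tperm -val_eqE neij.
by rewrite signrN mulNr opprK.
Qed.

(** A permutation takes the value k at exactly one position c, so the indicators add up to 1. *)
Lemma Alt_split k G : (k < n)%N ->
  Alt G = \sum_(c < n) Alt (fun f => (f c == k)%:R * G f).
Proof.
move=> kn; rewrite -(Alt_sum n (fun c f => (f c == k)%:R * G f)).
apply: eq_bigr => w _; congr (_ * _); rewrite -mulr_suml.
rewrite (bigD1 ((w^-1)%g (Ordinal kn))) //= perm_nat_ord permKV eqxx big1 ?addr0 ?mul1r //.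
move=> c nc; rewrite perm_nat_ord; case: eqP => // e; case/eqP: nc.
by apply: (@perm_inj _ w); rewrite permKV; apply: val_inj.
Qed.

(** Condition on a trailing factor under which exchanging rows at the first m positions affects only
    the product in front of it. *)
Definition sym_below m (T : Type) (g : (nat -> nat) -> T) :=
  forall i j f, (i < m)%N -> (j < m)%N -> g (f \o swap i j) = g f.

Lemma sym_belowW m (T : Type) (g : (nat -> nat) -> T) :
  sym_below m.+1 g -> sym_below m g.
Proof. by move=> gP i j f /ltnW im /ltnW jm; apply: gP. Qed.

(** * Skew-symmetry in the columns *)

Variable s : nat -> nat -> nat -> B.

(** Rows are read off [f] and columns off [b], so that rows can be antisymmetrized while columns are
    permuted. *)
Definition colprod m f b : B := \prod_(0 <= j < m) s j (f j) (b j).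

Lemma colprodS m f b : colprod m.+1 f b = colprod m f b * s m (f m) (b m).
Proof. exact: big_nat_recr. Qed.

Lemma eq_colprod m f f' b b' :
    (forall j, (j < m)%N -> f j = f' j) -> (forall j, (j < m)%N -> b j = b' j) ->
  colprod m f b = colprod m f' b'.
Proof.
by move=> ef eb; apply: eq_big_nat => j /andP[_ jm]; rewrite ef ?eb.
Qed.

Hypothesis scol : forall c i k a b : nat,
  s c i a * s c.+1 k b - s c k a * s c.+1 i b
  = - (s c i b * s c.+1 k a - s c k b * s c.+1 i a).

(** Exchanging rows c and c+1 rewrites twice the sum as one whose factors c and c+1 are
    antisymmetrized in their rows. There [scol] changes the sign when the columns are exchanged, and
    [B2] removes the factor 2. *)
Lemma Alt_col_adj m c b (rho : (nat -> nat) -> B) :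
  (c.+1 < m)%N -> (m <= n)%N -> sym_below m rho ->
  Alt (fun f => colprod m f (b \o swap c c.+1) * rho f)
  = - Alt (fun f => colprod m f b * rho f).
Proof.
move=> cm mn rhoP.
have ltc : (c < m)%N by apply: ltnW.
have ltc' := leq_trans ltc mn; have ltc1 := leq_trans cm mn.
pose pre f b := colprod c f b.
pose post f b := \prod_(c.+2 <= j < m) s j (f j) (b j).
have split_col f b' : colprod m f b' =
    pre f b' * (s c (f c) (b' c) * s c.+1 (f c.+1) (b' c.+1)) * post f b'.
  rewrite /colprod (big_cat_nat (n := c.+2)) //= big_nat_recr //= big_nat_recr //=.
  by rewrite !mulrA.
have anti b' : let G f := colprod m f b' * rho f in
    Alt G + Alt G = Alt (fun f => pre f b' *
      (s c (f c) (b' c) * s c.+1 (f c.+1) (b' c.+1)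
       - s c (f c.+1) (b' c) * s c.+1 (f c) (b' c.+1)) * post f b' * rho f).
  move=> G; rewrite -[X in _ + X]opprK -(Alt_swap G ltc' ltc1) ?ltn_eqF // -AltB.
  apply: eq_Alt => f; rewrite /G rhoP // !split_col /= swapL swapR.
  rewrite mulrBr !mulrBl; congr (_ - _ * _ * _ * _).
    apply: eq_colprod => // j jc /=.
    by rewrite swapD // ltn_eqF // ltnS ltnW.
  apply: eq_big_nat => j /andP[jc _] /=.
  by rewrite swapD // gtn_eqF // ltnW.
apply/eqP; rewrite -addr_eq0; apply/eqP/B2.
rewrite addrACA !anti -AltD; apply: Alt0 => f.
have -> : pre f (b \o swap c c.+1) = pre f b.
  by apply: eq_colprod => // j jc /=; rewrite swapD // ltn_eqF // ltnS ltnW.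
have -> : post f (b \o swap c c.+1) = post f b.
  by apply: eq_big_nat => j /andP[jc _] /=; rewrite swapD // gtn_eqF // ltnW.
by rewrite /= swapL swapR scol mulrN !mulNr addNr.
Qed.

Lemma Alt_col m c d b (rho : (nat -> nat) -> B) :
  (c < d)%N -> (d < m)%N -> (m <= n)%N -> sym_below m rho ->
  Alt (fun f => colprod m f (b \o swap c d) * rho f)
  = - Alt (fun f => colprod m f b * rho f).
Proof.
move=> cd dm mn rhoP; elim: d cd dm b => // d IHd; rewrite ltnS leq_eqVlt.
case/orP => [/eqP <- cm b|cd dm b]; first exact: Alt_col_adj.
(* The transposition (c d+1) is (c d) conjugated by the adjacent (d d+1), which gives three sign
   changes. *)
have -> : b \o swap c d.+1 = ((b \o swap d d.+1) \o swap c d) \o swap d d.+1.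
  apply/funext => k; rewrite /= /swap.
  have [cd' cd1' dd1] : [/\ (c == d) = false, (c == d.+1) = false & (d == d.+1) = false].
    by rewrite !ltn_eqF // ltnW.
  have [dc d1c d1d] : [/\ (d == c) = false, (d.+1 == c) = false & (d.+1 == d) = false].
    by split; rewrite eq_sym.
  pose E := (cd', cd1', dd1, dc, d1c, d1d, eqxx).
  case: (eqVneq k c) => [->|nkc]; first by rewrite !E.
  case: (eqVneq k d.+1) => [->|nkd1]; first by rewrite !E.
  case: (eqVneq k d) => [->|nkd]; first by rewrite !E.
  by rewrite !(negPf nkc, negPf nkd, negPf nkd1).
have dm' := ltnW dm.
by rewrite Alt_col_adj // IHd // Alt_col_adj // !opprK.
Qed.

(** Exchanging the equal columns fixes [b] but changes the sign, so the sum is its own opposite. *)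
Lemma Alt_col_eq0 m c d b (rho : (nat -> nat) -> B) :
  (c < m)%N -> (d < m)%N -> c != d -> (m <= n)%N -> sym_below m rho ->
  b c = b d -> Alt (fun f => colprod m f b * rho f) = 0.
Proof.
wlog cd : c d / (c < d)%N => [wlg|].
  rewrite neq_ltn => cm dm /orP[] lt; first by apply: wlg (lt) _ _ _; rewrite ?ltn_eqF.
  by move=> mn rhoP eb; apply: (wlg d c) => //; rewrite ltn_eqF.
move=> _ dm _ mn rhoP eb; apply: B2; rewrite -[X in X + _]opprK -(Alt_col (c := c) (d := d)) //.
have -> : b \o swap c d = b; last exact: addNr.
apply/funext => k; rewrite /= /swap; case: eqP => [->//|_].
by case: eqP => [->|].
Qed.


(** Columns are replaced from left to right. At column m the earlier columns are already those of
    [s], so each correction term contains some column k < m twice and vanishes; the factors further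
    right only see rows at positions beyond m. *)
Lemma Alt_col_span (S : nat -> nat -> B) :
    (forall j, (j < n)%N -> exists a : nat -> B,
       forall i, S j i = s j i j + \sum_(k < j) s j i k * a k) ->
  Alt (fun f => \prod_(0 <= j < n) S j (f j)) = Alt (fun f => colprod n f id).
Proof.
move=> SE; pose R m f := \prod_(m <= j < n) S j (f j).
suff H m : (m <= n)%N ->
    Alt (fun f => colprod m f id * R m f) = Alt (fun f => \prod_(0 <= j < n) S j (f j)).
  by rewrite -(H n) //; apply: eq_Alt => f; rewrite /R big_geq // mulr1.
elim: m => [_|m IHm mn].
  by apply: eq_Alt => f; rewrite /colprod big_geq // mul1r.
rewrite -IHm ?(ltnW mn) //; have [a SmE] := SE m mn.
have RP (q : B) : sym_below m.+1 (fun f => q * R m.+1 f).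
  move=> i j f im jm; congr (_ * _); apply: eq_big_nat => k /andP[mk _] /=.
  by rewrite swapD // gtn_eqF // (leq_trans _ mk).
rewrite [RHS](eq_Alt (H := fun f => colprod m.+1 f id * R m.+1 f
    + \sum_(k < m) colprod m.+1 f (upd id m k) * (a k * R m.+1 f))) => [|f].
  rewrite AltD (Alt_sum m (fun k f => colprod m.+1 f (upd id m k) * (a k * R m.+1 f))).
  rewrite [X in _ = _ + X]big1 ?addr0 // => k _.
  have km := ltn_ord k; apply: (@Alt_col_eq0 m.+1 k m) => //.
  - exact: ltnW.
  - by rewrite ltn_eqF.
  by rewrite /upd eqxx (ltn_eqF km).
rewrite [in LHS]/R big_ltn // SmE mulrDl mulrDr colprodS !mulrA; congr (_ + _).
rewrite mulr_sumr mulr_suml; apply: eq_bigr => k _.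
rewrite colprodS /upd eqxx !mulrA; congr (_ * _ * _ * _).
by apply: eq_colprod => // j jm; rewrite ltn_eqF.
Qed.

(** * The commutator of T(u) with an antisymmetrized product *)

Variables (t : nat -> nat -> B) (alpha beta : B).
Hypothesis alphaC : forall z, alpha * z = z * alpha.
Hypothesis betaC : forall z, beta * z = z * beta.
(* With t = T(u), s c = T(v - c), alpha = 1/(uv) and beta = 1/v - 1/u, [beta_ c] is
   (u - v + c)/(uv), and [t_s] below is the defining relation of the Yangian. *)
Let beta_ c := beta + alpha *+ c.
Hypothesis beta_lreg : forall c z, beta_ c * z = 0 -> z = 0.
Hypothesis t_s : forall c k l i j,
  beta_ c * comm (t k l) (s c i j) = alpha * (t i l * s c k j - s c i l * t k j).

Let beta_C c z : beta_ c * z = z * beta_ c.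
Proof. by rewrite mulrDl mulrDr betaC mulrnAl mulrnAr alphaC. Qed.

(** Since [beta_ c] and [alpha] commute with everything, [t_s] can be applied in the middle of each
    summand. *)
Let Alt_t_s c (p q : (nat -> nat) -> B) (k i : (nat -> nat) -> nat) l j :
  beta_ c * Alt (fun f => p f * comm (t (k f) l) (s c (i f) j) * q f)
  = alpha * (Alt (fun f => p f * t (i f) l * s c (k f) j * q f)
             - Alt (fun f => p f * s c (i f) l * t (k f) j * q f)).
Proof.
rewrite -AltB -!AltMl; apply: eq_Alt => f.
transitivity (p f * (beta_ c * comm (t (k f) l) (s c (i f) j)) * q f).
  by rewrite !mulrA beta_C.
rewrite t_s (mulrA (p f)) -alphaC -!mulrA; congr (alpha * _).
by rewrite !(mulrBl, mulrBr, mulrA).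
Qed.

(** In [Uc], t exchanges its row with factor c and stands on the left; in [Vc], it exchanges its
    column and stands to the right of the product. The row [k] may depend on the permutation, so
    that [f m] is allowed. *)
Let Lc m (k : (nat -> nat) -> nat) l b (rho : (nat -> nat) -> B) :=
  Alt (fun f => comm (t (k f) l) (colprod m f b) * rho f).
Let Uc m (k : (nat -> nat) -> nat) l b (rho : (nat -> nat) -> B) :=
  \sum_(c < m) Alt (fun f => t (f c) l * colprod m (upd f c (k f)) b * rho f).
Let Vc m (k : (nat -> nat) -> nat) l b (rho : (nat -> nat) -> B) :=
  \sum_(c < m) Alt (fun f => colprod m f (upd b c l) * t (k f) (b c) * rho f).

(* Expanding the last factor s_m reduces the step to the vanishing of
   A1 - A2 + N *+ m + Z, which is checked after multiplication by [beta_ m]; the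
   induction hypothesis is used once with [k] and once with the row [f m]. *)
Lemma comm_colprod m k l b rho : (m <= n)%N -> sym_below m k -> sym_below m rho ->
  beta * Lc m k l b rho = alpha * (Uc m k l b rho - Vc m k l b rho).
Proof.
elim: m k l b rho => [|m IHm] k l b rho mn kP rhoP.
  rewrite /Uc /Vc !big_ord0 subrr mulr0 /Lc Alt0 ?mulr0 // => f.
  by rewrite /colprod big_geq // /comm mulr1 mul1r subrr mul0r.
have mn' := ltnW mn; set q := b m.
pose rho1 f := s m (f m) q * rho f.
pose rho2 f := s m (k f) q * rho f.
pose A1 := Alt (fun f => t (f m) l * colprod m f b * s m (k f) q * rho f).
pose A2 := Alt (fun f => colprod m f b * t (f m) l * s m (k f) q * rho f).
pose A3 := Alt (fun f => colprod m f b * s m (f m) l * t (k f) q * rho f).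
pose N := Alt (fun f => colprod m f b * comm (t (k f) l) (s m (f m) q) * rho f).
pose Z := \sum_(c < m) Alt (fun f =>
  colprod m f (upd b c l) * comm (t (k f) (b c)) (s m (f m) q) * rho f).
pose W := \sum_(c < m) Alt (fun f =>
  colprod m f (upd b c l) * t (f m) (b c) * s m (k f) q * rho f).
have swap_lt i j (f : nat -> nat) : (i < m)%N -> (j < m)%N -> (f \o swap i j) m = f m.
  by move=> im jm; rewrite /= swapD // gtn_eqF.
have rho1P : sym_below m rho1.
  by move=> i j f im jm; rewrite /rho1 swap_lt // rhoP // ltnW.
have rho2P : sym_below m rho2.
  by move=> i j f im jm; rewrite /rho2 kP ?rhoP // ltnW.
have E1 : Lc m.+1 k l b rho = Lc m k l b rho1 + N.
  rewrite -AltD; apply: eq_Alt => f; rewrite colprodS /comm /rho1.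
  by rewrite !(mulrBl, mulrBr, mulrA) addrA subrK.
have E2 : Uc m.+1 k l b rho = Uc m k l b rho1 + A1.
  rewrite /Uc big_ord_recr /=; congr (_ + _).
    apply: eq_bigr => c _; apply: eq_Alt => f.
    by rewrite colprodS /upd gtn_eqF // /rho1 !mulrA.
  apply: eq_Alt => f; rewrite colprodS /upd eqxx !mulrA.
  congr (_ * _ * _ * _); apply: eq_colprod => // j jm.
  by rewrite ltn_eqF.
(* In [Vc m.+1], t stands to the right of [s m]; moving it to the left costs the commutators
   collected in [Z]. *)
have E3 : Vc m.+1 k l b rho = Vc m k l b rho1 - Z + A3.
  rewrite /Vc big_ord_recr /= -sumrB; congr (_ + _).
    apply: eq_bigr => c _; rewrite -AltB; apply: eq_Alt => f.
    rewrite colprodS /upd gtn_eqF // /rho1 /comm !(mulrBl, mulrBr, mulrA).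
    by rewrite subKr.
  apply: eq_Alt => f; rewrite colprodS /upd eqxx.
  congr (_ * _ * _ * _); apply: eq_colprod => // j jm.
  by rewrite ltn_eqF.
have E4 : beta_ m * N = alpha * (A2 - A3) by rewrite Alt_t_s.
(* The induction hypothesis for the row [f m]: each term of its [Uc] is [- A1] after exchanging rows
   c and m, and its [Vc] is [W]. *)
have E5 : beta * (A1 - A2) = alpha * (- (A1 *+ m) - W).
  have -> : A1 - A2 = Lc m (fun f => f m) l b rho2.
    by rewrite -AltB; apply: eq_Alt => f; rewrite /comm /rho2 !mulrBl !mulrA.
  rewrite IHm //; congr (_ * (_ - _)); last first.
    by apply: eq_bigr => c _; apply: eq_Alt => f; rewrite /rho2 !mulrA.
  rewrite /Uc (eq_bigr (fun=> - A1)) => [|c _].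
    by rewrite sumr_const card_ord mulNrn.
  have cm := ltn_ord c.
  rewrite -(Alt_swap _ (leq_trans cm mn') mn) ?ltn_eqF //; apply: eq_Alt => f /=.
  rewrite swapR kP ?rhoP // 1?ltnW // /rho2 !mulrA; congr (_ * _ * _ * _).
  apply: eq_colprod => // j jm; rewrite /upd /= /swap.
  by rewrite (ltn_eqF jm); case: ifP.
(* After [t_s], exchanging columns c and m, which hold [l] and [b c], turns each subtracted term
   into [- A3]. *)
have E6 : beta_ m * Z = alpha * (W + A3 *+ m).
  have -> : A3 *+ m = - \sum_(c < m) Alt (fun f =>
      colprod m f (upd b c l) * s m (f m) (b c) * t (k f) q * rho f).
    rewrite (eq_bigr (fun=> - A3)) => [|c _].
      by rewrite sumr_const card_ord mulNrn opprK.
    have cm := ltn_ord c.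
    rewrite [in RHS]/A3 (eq_Alt (H := fun f =>
        colprod m.+1 f (upd b m l \o swap c m) * (t (k f) q * rho f))) => [|f].
      rewrite Alt_col //; last by move=> i j f im jm; rewrite kP ?rhoP.
      congr (- _); apply: eq_Alt => f; rewrite colprodS /upd eqxx !mulrA.
      by congr (_ * _ * _ * _); apply: eq_colprod => // j jm; rewrite ltn_eqF.
    rewrite colprodS /= swapR /upd (ltn_eqF cm) !mulrA.
    congr (_ * _ * _ * _); apply: eq_colprod => // j jm.
    by rewrite /= /swap (ltn_eqF jm); case: eqP => _; rewrite ?eqxx // (ltn_eqF jm).
  rewrite /W -sumrB !mulr_sumr; apply: eq_bigr => c _; exact: Alt_t_s.
have X0 : A1 - A2 + N *+ m + Z = 0.
  apply: (@beta_lreg m); rewrite !(mulrDr _ _ Z) mulrDr E6 mulrnAr E4.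
  rewrite [beta_ m * _]mulrDl E5 mulrnAl -!mulrnAr -!mulrDr -[RHS](mulr0 alpha).
  congr (_ * _); rewrite -(addrA _ ((A1 - A2) *+ m)) -mulrnDl subrKA mulrnBl.
  by rewrite -addrA (addrC W) subrKA -opprD addNr.
have bN : beta * N = alpha * (A2 - A3 - N *+ m).
  by rewrite mulrBr -E4 mulrnAr -mulrnAl -mulrBl addrK.
rewrite E1 E2 E3 mulrDr IHm //; last exact: sym_belowW.
rewrite bN -mulrDr; congr (_ * _).
have -> : A2 - A3 - N *+ m = A1 - A3 + Z.
  have -> : - (N *+ m) = A1 - A2 + Z.
    by apply/eqP; rewrite eq_sym -subr_eq0 opprK addrAC X0.
  by rewrite !addrA [LHS](ACl ((1*4)*3*2*5)) /= subrr add0r.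
by rewrite !opprD !opprK !addrA [LHS](ACl (1*3*2*5*4)) /=.
Qed.

Variable l : nat.
Hypothesis ln : (l < n)%N.
Hypothesis bma_lreg : forall z, (beta - alpha) * z = 0 -> z = 0.

(** With all n columns present, [Uc] collapses to [t k l * Q] and [Vc] to [Q * t k l], so
    [comm_colprod] says that [beta - alpha] kills the commutator. *)
Lemma comm_Alt_colprod k : (k < n)%N ->
  comm (t k l) (Alt (fun f => colprod n f id)) = 0.
Proof.
move=> kn; set Q := Alt _.
pose one (f : nat -> nat) : B := 1.
have eqQ : Q = Alt (fun f => colprod n f id * one f).
  by apply: eq_Alt => f; rewrite mulr1.
have LE : Lc n (fun=> k) l id one = comm (t k l) Q.
  by rewrite /Lc /comm -AltMl -AltMr -AltB; apply: eq_Alt => f; rewrite mulr1.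
(* For c other than l, column l occurs twice; only the term c = l survives. *)
have VE : Vc n (fun=> k) l id one = Q * t k l.
  rewrite /Vc (bigD1 (Ordinal ln)) //= big1 ?addr0 => [|c ncl].
    rewrite -AltMr; apply: eq_Alt => f; rewrite mulr1; congr (_ * _).
    by apply: eq_colprod => // j _; rewrite /upd; case: eqP.
  rewrite (eq_Alt (H := fun f => colprod n f (upd id c l) * (fun=> t k c) f)) => [|f].
    apply: (@Alt_col_eq0 _ c l) => //.
    by rewrite /upd eqxx; case: eqP.
  by rewrite mulr1.
(* Each term is split by the position d with [f d = k]. For d other than c, row k occurs at both c
   and d, and the terms for (c, d) and (d, c) cancel; those with d = c add up to [t k l * Q]. *)
have UE : Uc n (fun=> k) l id one = t k l * Q.
  rewrite /Uc.
  pose G (c d : nat) := Alt (fun f =>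
    (f d == k)%:R * (t (f c) l * colprod n (upd f c k) id)).
  have GN c d : (c < n)%N -> (d < n)%N -> c != d -> G c d = - G d c.
    move=> cn dn ncd; rewrite -(Alt_swap _ cn dn ncd); apply: eq_Alt => f /=.
    rewrite swapL swapR; case: eqP => [fdk|]; last by rewrite !mul0r.
    congr (_ * (_ * _)); apply: eq_colprod => // j _.
    rewrite /upd /= /swap; case: (eqVneq j c) => [->|_]; first by rewrite (negPf ncd) fdk.
    by case: eqP => [->|].
  pose H c d := if c == d then 0 else G c d.
  have H0 : \sum_(c < n) \sum_(d < n) H c d = 0.
    apply: B2; rewrite {2}exchange_big /= -big_split big1 // => c _ /=.
    rewrite -big_split big1 // => d _ /=; rewrite /H eq_sym.
    by case: eqVneq => [_|ndc]; rewrite ?addr0 // (GN c d) 1?eq_sym // addNr.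
  have Gd c d : G c d = H c d + (c == d)%:R * G c c.
    by rewrite /H; case: eqVneq => [->|_]; rewrite ?add0r ?mul1r // mul0r addr0.
  transitivity (\sum_(c < n) \sum_(d < n) (H c d + (c == d)%:R * G c c)).
    apply: eq_bigr => c _; rewrite (Alt_split _ kn); apply: eq_bigr => d _.
    by rewrite -Gd; apply: eq_Alt => f; rewrite mulr1.
  under eq_bigr do rewrite big_split /=.
  rewrite big_split /= H0 add0r /Q -AltMl (Alt_split _ kn); apply: eq_bigr => c _.
  rewrite (bigD1 c) //= eqxx mul1r big1 ?addr0 => [|d /negPf ndc].
    apply: eq_Alt => f; case: eqP => [fck|]; last by rewrite !mul0r.
    rewrite fck; congr (_ * (_ * _)); apply: eq_colprod => // j _.
    by rewrite /upd; case: eqP => [->|].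
  by rewrite eq_sym ndc mul0r.
apply: bma_lreg; rewrite mulrBl -LE comm_colprod //.
by rewrite UE VE LE subrr.
Qed.
End Alternation.

Lemma psC1 (A : nzRingType) : psC (1 : A) = 1.
Proof. by apply/funext => -[|m]. Qed.

Lemma psC0 (A : nzRingType) : psC (0 : A) = 0.
Proof. by apply/funext => -[|m]. Qed.

Lemma ps_2torsion_free (A : nzRingType) :
  (forall z : A, z + z = 0 -> z = 0) -> forall z : pseries A, z + z = 0 -> z = 0.
Proof.
by move=> A2 z z2; apply/funext => m; apply: A2; rewrite -psD z2.
Qed.

Lemma ps_sign (A : nzRingType) (b : bool) (f : pseries A) m :
  ((-1) ^+ b * f) m = (-1) ^+ b * f m.
Proof. by case: b; rewrite ?expr0 ?expr1 ?mul1r ?mulN1r. Qed.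

Lemma ps_comm (A : nzRingType) (f g : pseries A) m :
  comm f g m = (f * g) m - (g * f) m.
Proof. by []. Qed.

Lemma comm0 (A : nzRingType) (z : A) : comm z 0 = 0.
Proof. by rewrite /comm mulr0 mul0r subrr. Qed.

Lemma commD (A : nzRingType) (z x y : A) : comm z (x + y) = comm z x + comm z y.
Proof. by rewrite /comm mulrDl mulrDr opprD addrACA. Qed.

Lemma comm_Dl (A : nzRingType) (z x y : A) : comm (x + y) z = comm x z + comm y z.
Proof. by rewrite /comm mulrDl mulrDr opprD addrACA. Qed.

Lemma commMn (A : nzRingType) (z x : A) m : comm z (x *+ m) = comm z x *+ m.
Proof. by rewrite /comm mulrnAl mulrnAr mulrnBl. Qed.

Lemma cdetE (A : nzRingType) n (M : nat -> nat -> nat -> A) :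
  cdet n M =
  Alt n (fun f => \prod_(0 <= j < n) (M (f j) j : pseries A)) :> pseries A.
Proof.
apply/funext => m; rewrite /Alt ps_sum; apply: eq_bigr => w _.
rewrite ps_sign; congr (_ * _).
have -> : \prod_(0 <= j < n) (M (perm_nat w j) j : pseries A)
    = \prod_(j <- enum 'I_n) (M (w j) j : pseries A).
  rewrite big_mkord enumT [index_enum _]unlock; apply: eq_bigr => j _.
  by rewrite perm_nat_ord.
elim: (enum _) m => [|j r IHr] m; first by rewrite big_nil.
rewrite big_cons psM; apply: eq_bigr => k _; congr (_ * _); exact: IHr.
Qed.

(** * Centrality of the quantum determinant *)

Section Yangian.
Variables (A : nzRingType) (n : nat) (T : nat -> nat -> nat -> A).
Hypothesis TP : yangian_rel n T.
Hypothesis A2 : forall z : A, z + z = 0 -> z = 0.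

(* Vanishes for out-of-range indices, so that the relations hold without side
   conditions. *)
Definition T0 (i j : nat) : pseries A :=
  fun r => if (i < n)%N && (j < n)%N then Tser T i j r else 0.

Lemma comm_T0_0l k l z : comm (T0 k l 0%N) z = 0.
Proof.
rewrite /comm /T0 /Tser; case: ifP => _; last by rewrite mulr0 mul0r subrr.
by case: eqP => _; rewrite ?mul1r ?mulr1 ?mulr0 ?mul0r subrr.
Qed.

Lemma comm_T0_0r k l z : comm z (T0 k l 0%N) = 0.
Proof. by apply/eqP; rewrite -oppr_eq0 opprB; apply/eqP/comm_T0_0l. Qed.

Let X k l i j p q := Tser T i l p * Tser T k j q.

(** The reflection t -> r+s-1-t preserves the interval [s, r) and reverses the sign of the
    summand. *)
Let X_antisym k l i j r s : (s <= r)%N ->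
  \sum_(s <= t < r) (X k l i j t (r + s - 1 - t)%N - X k l i j (r + s - 1 - t)%N t) = 0.
Proof.
move=> sr; rewrite sumrB [X in X - _]big_nat_rev -sumrB big_nat big1 // => t /andP[st tr].
have E : (s + r - t.+1 = r + s - 1 - t)%N by lia.
rewrite E subKn ?subrr //.
lia.
Qed.

(** The terms beyond min(r, s) cancel by [X_antisym], so the sum may run up to r, and zero indices
    are allowed as well. *)
Let comm_TE k l i j r s : (k < n)%N -> (l < n)%N -> (i < n)%N -> (j < n)%N ->
  comm (T0 k l r) (T0 i j s) =
  \sum_(0 <= t < r) (X k l i j t (r + s - 1 - t)%N - X k l i j (r + s - 1 - t)%N t).
Proof.
move=> kn ln i_n jn; case: r => [|r]; first by rewrite big_geq // comm_T0_0l.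
case: s => [|s]; first by rewrite comm_T0_0r X_antisym.
rewrite /T0 kn ln i_n jn /= TP //.
rewrite -(big_mkord xpredT (fun t =>
  X k l i j t (r.+1 + s.+1 - 1 - t)%N - X k l i j (r.+1 + s.+1 - 1 - t)%N t)).
rewrite /minn; case: ltnP => // sr; symmetry.
by rewrite (big_cat_nat (n := s.+1)) //= X_antisym // addr0.
Qed.

(** Both commutators have the same total index, so their expansions differ only in the term t = a.
    This is the coefficient form of the relation for (u - v)[T(u), T(v)]. *)
Lemma T0_rel k l i j a b :
  comm (T0 k l a.+1) (T0 i j b) - comm (T0 k l a) (T0 i j b.+1)
  = T0 i l a * T0 k j b - T0 i l b * T0 k j a.
Proof.
case kn: (k < n)%N; last by rewrite /T0 kn /comm !(mul0r, mulr0, subr0).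
case i_n: (i < n)%N; last by rewrite /T0 i_n /= !comm0 !mul0r.
case ln: (l < n)%N; last by rewrite /T0 ln !andbF /comm !(mul0r, mulr0, subr0).
case jn: (j < n)%N; last by rewrite /T0 jn !andbF !comm0 !mulr0.
rewrite !comm_TE // big_nat_recr //= addSn addnS addrC -addrA.
rewrite subn1 /= addKn.
by rewrite subrr addr0 /T0 kn ln i_n jn.
Qed.

Definition Ts c i j : pseries A := ps_shift c (T0 i j).

Lemma comm_Ts_0l c k l z : comm (Ts c k l 0%N) z = 0.
Proof. by rewrite /Ts ps_shift0 comm_T0_0l. Qed.

Lemma comm_Ts_0r c k l z : comm z (Ts c k l 0%N) = 0.
Proof. by rewrite /Ts ps_shift0 comm_T0_0r. Qed.

(** Replacing v by v - c in [T0_rel] turns u - v into u - v + c; [ps_shiftS] applies because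
    commutators with the zeroth coefficient vanish. *)
Lemma T0_Ts_rel c k l i j a b :
  comm (T0 k l a.+1) (Ts c i j b) - comm (T0 k l a) (Ts c i j b.+1)
    + comm (T0 k l a) (Ts c i j b) *+ c
  = T0 i l a * Ts c k j b - Ts c i l b * T0 k j a.
Proof.
have commE z x : comm z (Ts c i j x) = ps_shift c (fun r => comm z (T0 i j r)) x.
  by apply: (@ps_shift_morph _ _ _ (comm z)) => *; rewrite commD.
have mulE z : z * Ts c k j b = ps_shift c (fun r => z * T0 k j r) b.
  by apply: (@ps_shift_morph _ _ _ (fun x => z * x)) => *; rewrite mulrDr.
have mulE' z : Ts c i l b * z = ps_shift c (fun r => T0 i l r * z) b.
  by apply: (@ps_shift_morph _ _ _ (fun x => x * z)) => *; rewrite mulrDl.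
rewrite !commE mulE mulE'.
rewrite (@ps_shiftS _ _ _ b) ?comm_T0_0r // opprD addrA addrAC subrK -!ps_shiftN -!ps_shiftD.
by congr (ps_shift c _ b); apply/funext => r; rewrite /= T0_rel.
Qed.

Lemma Ts_Ts_rel c d k l i j a b :
  comm (Ts c k l a.+1) (Ts d i j b) - comm (Ts c k l a) (Ts d i j b.+1)
    + comm (Ts c k l a) (Ts d i j b) *+ d - comm (Ts c k l a) (Ts d i j b) *+ c
  = Ts c i l a * Ts d k j b - Ts d i l b * Ts c k j a.
Proof.
have commE x z : comm (Ts c k l x) z = ps_shift c (fun r => comm (T0 k l r) z) x.
  by apply: (@ps_shift_morph _ _ _ (fun x => comm x z)) => *; rewrite comm_Dl.
have mulE z : Ts c i l a * z = ps_shift c (fun r => T0 i l r * z) a.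
  by apply: (@ps_shift_morph _ _ _ (fun x => x * z)) => *; rewrite mulrDl.
have mulE' z : z * Ts c k j a = ps_shift c (fun r => z * T0 k j r) a.
  by apply: (@ps_shift_morph _ _ _ (fun x => z * x)) => *; rewrite mulrDr.
rewrite -commMn !commE mulE mulE' ps_shiftS ?comm_T0_0l //.
rewrite [LHS](ACl (1*5*2*3*4)) /= subrr add0r -!ps_shiftN -!ps_shiftD.
congr (ps_shift c _ a); apply/funext => r; rewrite commMn.
exact: T0_Ts_rel.
Qed.

(** At u = v the factor u - v + 1 in [Ts_Ts_rel] becomes 1. On coefficients: summing over a + b = m
    makes the first two commutators telescope, with zero boundary terms since zeroth coefficients
    are central. *)
Lemma comm_Ts c k l i j :
  comm (Ts c k l) (Ts c.+1 i j) = Ts c i l * Ts c.+1 k j - Ts c.+1 i l * Ts c k j.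
Proof.
have rel a b : Ts c i l a * Ts c.+1 k j b - Ts c.+1 i l b * Ts c k j a
    = comm (Ts c k l a.+1) (Ts c.+1 i j b) - comm (Ts c k l a) (Ts c.+1 i j b.+1)
      + comm (Ts c k l a) (Ts c.+1 i j b).
  by rewrite -(Ts_Ts_rel c c.+1) mulrS addrA addrK.
have mulE (f g : pseries A) m : (f * g) m = \sum_(0 <= a < m.+1) f a * g (m - a)%N.
  by rewrite psM big_mkord.
have mulrE (f g : pseries A) m : (g * f) m = \sum_(0 <= a < m.+1) g (m - a)%N * f a.
  by rewrite mulE big_nat_rev; apply: eq_big_nat => a am; congr (g _ * f _); lia.
apply/funext => m; rewrite [RHS]psD psN ps_comm.
rewrite !(mulE (Ts c _ _)) !(mulrE (Ts c _ _)) -!sumrB.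
pose G a := comm (Ts c k l a) (Ts c.+1 i j (m.+1 - a)%N).
transitivity (\sum_(0 <= a < m.+1) (G a.+1 - G a + comm (Ts c k l a) (Ts c.+1 i j (m - a)%N))).
  by rewrite [RHS]big_split /= telescope_sumr //= /G subnn comm_Ts_0r comm_Ts_0l subrr add0r.
by apply: eq_big_nat => a am; rewrite rel /G subSS subSn.
Qed.

(** Two instances of [comm_Ts], with a and b interchanged, express both differences through the same
    products in the opposite order, with opposite signs. *)
Lemma Ts_col c i k a b :
  Ts c i a * Ts c.+1 k b - Ts c k a * Ts c.+1 i b
  = - (Ts c i b * Ts c.+1 k a - Ts c k b * Ts c.+1 i a).
Proof.
have := comm_Ts c i a k b; have := comm_Ts c i b k a; rewrite /comm.
move=> /eqP; rewrite subr_eq => /eqP E1 /eqP; rewrite subr_eq => /eqP E2.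
have aux (x y z : pseries A) : x - y + z - x = z - y.
  by rewrite addrAC (addrAC x) subrr sub0r addrC.
by rewrite E1 E2 !aux opprB.
Qed.


Definition qdet : pseries A := Alt n (fun f => colprod Ts n f id).

Let L := pseries A.
Let x : pseries L := psX L.
Let y : pseries L := psC (psX A).

Let xC z : x * z = z * x. Proof. exact: psX_comm. Qed.
Let yC z : y * z = z * y.
Proof. by apply/funext => a; rewrite psCM psMC psX_comm. Qed.

Let psX_lreg (z : L) : psX A * z = 0 -> z = 0.
Proof.
move=> z0; apply/funext => m; have /(congr1 (@^~ m.+1)) := z0.
by rewrite /= psXM.
Qed.

(** In y z = x w z, coefficient a of the right side only involves coefficients of z below a; by
    induction it vanishes, and y cancels. The free [w] covers both 1 - c y and 1 + y. *)
Let ymx_lreg w z : (y - x * w) * z = 0 -> z = 0.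
Proof.
rewrite mulrBl => /eqP; rewrite subr_eq0 -mulrA => /eqP yzE.
apply/funext; elim/ltn_ind => a IHa; apply: psX_lreg.
rewrite -[LHS](psCM (psX A) z) -/y yzE psXM; case: a IHa => // a IHa.
rewrite psM big1 // => i _; rewrite IHa ?mulr0 //.
by rewrite ltnS leq_subr.
Qed.

(** T(u) and T(v - c) inside A[[y]][[x]]: the first is constant in y, the second in x. *)
Let tB k l : pseries L := fun a => psC (T0 k l a).
Let sB c i j : pseries L := psC (Ts c i j).
Let alpha := x * y.
Let beta := y - x.

(** The coefficient of x^{a+1} y^{b+1} is [T0_Ts_rel]; those with a zero exponent vanish because
    zeroth coefficients of T are central. *)
Let tB_sB c k l i j :
  (beta + alpha *+ c) * comm (tB k l) (sB c i j)
  = alpha * (tB i l * sB c k j - sB c i l * tB k j).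
Proof.
have commE a : comm (tB k l) (sB c i j) a = comm (psC (T0 k l a)) (Ts c i j).
  by rewrite ps_comm psMC psCM.
have commEE a b : comm (psC (T0 k l a)) (Ts c i j) b = comm (T0 k l a) (Ts c i j b).
  by rewrite ps_comm psMC psCM.
have rhsE a : (tB i l * sB c k j - sB c i l * tB k j) a =
    psC (T0 i l a) * Ts c k j - Ts c i l * psC (T0 k j a).
  by rewrite psD psN psMC psCM.
apply/funext => a; rewrite mulrDl mulrBl mulrnAl.
rewrite psD psMn psD psN psCM -!mulrA !psXM commE.
case: a => [|a].
  rewrite mul0rn subr0 addr0; apply/funext => b; rewrite psXM.
  by case: b => // b; rewrite commEE comm_T0_0l.
rewrite !psCM rhsE commE; apply/funext => b.
rewrite psD psMn psD psN !psXM commEE; case: b => [|b].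
  by rewrite comm_Ts_0r subr0 mul0rn addr0.
by rewrite !commEE T0_Ts_rel psD psN psCM psMC.
Qed.

Lemma qdet_central k l a m : (k < n)%N -> (l < n)%N ->
  comm (T0 k l a) (qdet m) = 0.
Proof.
move=> kn ln.
have scol c i k' a' b : sB c i a' * sB c.+1 k' b - sB c k' a' * sB c.+1 i b
    = - (sB c i b * sB c.+1 k' a' - sB c k' b * sB c.+1 i a').
  by rewrite /sB -!psCMM -!psCN -!psCD Ts_col psCN.
have := @comm_Alt_colprod _ n (ps_2torsion_free (ps_2torsion_free A2)) sB scol tB
  alpha beta _ _ _ tB_sB l ln _ k kn.
have -> : Alt n (fun f => colprod sB n f id) = psC qdet.
  rewrite /qdet /Alt (big_morph _ (@psCD _) (psC0 _)).
  apply: eq_bigr => w _; rewrite psCMM; congr (_ * _).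
    by case: (w : bool); rewrite ?psC1 // expr1 psCN psC1.
  by rewrite /colprod (big_morph _ (@psCMM _) (@psC1 _)).
move=> H; have {}H : comm (tB k l) (psC qdet) = 0.
  apply: H.
  - by move=> z; rewrite /alpha -mulrA (yC z) mulrA (xC z) -mulrA.
  - by move=> z; rewrite mulrBl mulrBr yC xC.
  - move=> c z; have -> : beta + alpha *+ c = y - x * (1 - y *+ c).
      by rewrite mulrBr mulr1 opprB addrA addrAC mulrnAr.
    exact: ymx_lreg.
  move=> z; have -> : beta - alpha = y - x * (1 + y).
    by rewrite mulrDr mulr1 opprD addrA.
  exact: ymx_lreg.
have -> : comm (T0 k l a) (qdet m) = comm (tB k l) (psC qdet) a m.
  by rewrite ps_comm psMC psCM psD psN psMC psCM.
by rewrite H.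
Qed.

End Yangian.

Lemma eq_cdet (A : nzRingType) n (M M' : nat -> nat -> nat -> A) :
  (forall i j, (i < n)%N -> (j < n)%N -> M i j = M' i j) -> cdet n M = cdet n M'.
Proof.
move=> eM; apply/funext => m; apply: eq_bigr => w _; congr (_ * _).
elim: (enum _) m => //= j r IHr m; rewrite eM //.
by apply: eq_bigr => k _; rewrite IHr.
Qed.

Lemma big_ord_min (V : nmodType) n i j (f : nat -> V) : (i < n)%N -> (j < n)%N ->
  \sum_(k < n | (k <= i)%N && (k <= j)%N) f k = \sum_(k < (minn i j).+1) f k.
Proof.
move=> i_n jn; rewrite (big_ord_widen n) ?gtn_min ?i_n //.
by apply: eq_bigl => k; rewrite ltnS leq_min.
Qed.

Lemma comm_comm (A : nzRingType) (x z : A) : comm x z = 0 -> GRing.comm x z.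
Proof. by move=> /eqP; rewrite subr_eq0 => /eqP. Qed.

(** * Gauss factors *)

Section Gauss.
Variables (A : nzRingType) (n : nat) (T : nat -> nat -> nat -> A).
Variables (D : nat -> nat -> A) (E F : nat -> nat -> nat -> A).
Hypothesis TDEF : gauss_factorization n T D E F.

Let Dp k : pseries A := D k.
Let Ep k j : pseries A := tri_entry E k j.
Let Fp k i : pseries A := tri_entry F k i.
Let Tp i j : pseries A := Tser T i j.

Let D0 k : (k < n)%N -> D k 0%N = 1. Proof. by case: TDEF => + _; apply. Qed.
Let E0 k j : (k < j)%N -> (j < n)%N -> E k j 0%N = 0.
Proof. by move=> kj jn; case: TDEF => _ [/(_ k j kj jn) []]. Qed.
Let F0 k j : (k < j)%N -> (j < n)%N -> F k j 0%N = 0.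
Proof. by move=> kj jn; case: TDEF => _ [/(_ k j kj jn) []]. Qed.

Let EpE k j : (k < j)%N -> Ep k j = E k j.
Proof. by move=> kj; rewrite /Ep /tri_entry ltn_eqF. Qed.
Let FpE k j : (k < j)%N -> Fp k j = F k j.
Proof. by move=> kj; rewrite /Fp /tri_entry ltn_eqF. Qed.
Let Epp k : Ep k k = 1. Proof. by rewrite /Ep /tri_entry eqxx. Qed.
Let Fpp k : Fp k k = 1. Proof. by rewrite /Fp /tri_entry eqxx. Qed.

Let gaussE i j : (i < n)%N -> (j < n)%N ->
  Tp i j = \sum_(k < n | (k <= i)%N && (k <= j)%N) Fp k i * Dp k * Ep k j.
Proof.
move=> i_n jn; apply/funext => m; case: TDEF => _ [_ H].
by rewrite /Tp H // ps_sum.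
Qed.

Let gauss_row k j : (k <= j)%N -> (j < n)%N ->
  Tp k j = \sum_(l < k) Fp l k * Dp l * Ep l j + Dp k * Ep k j.
Proof.
move=> kj jn; have kn := leq_ltn_trans kj jn.
rewrite gaussE // (big_ord_min (fun l => Fp l k * Dp l * Ep l j)) //.
by rewrite (minn_idPl kj) big_ord_recr /= Fpp mul1r.
Qed.

Let gauss_col k i : (k <= i)%N -> (i < n)%N ->
  Tp i k = \sum_(l < k) Fp l i * Dp l * Ep l k + Fp k i * Dp k.
Proof.
move=> ki i_n; have kn := leq_ltn_trans ki i_n.
rewrite gaussE // (big_ord_min (fun l => Fp l i * Dp l * Ep l k)) //.
by rewrite (minn_idPr ki) big_ord_recr /= Epp mulr1.
Qed.

(** Induction on k: removing the terms l < k from row k and column k of T leaves D_k E_{k,j} and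
    F_{k,i} D_k. The diagonal entry gives D_k, which cancels because its constant term is 1.
    Assuming commutation only with the leading block of size m is what [F_comm] requires. *)
Let gauss_commute (z : pseries A) m k : (m <= n)%N -> (k < m)%N ->
    (forall i j, (i < m)%N -> (j < m)%N -> GRing.comm z (Tp i j)) ->
  [/\ GRing.comm z (Dp k),
      forall j, (k <= j)%N -> (j < m)%N -> GRing.comm z (Ep k j)
    & forall i, (k <= i)%N -> (i < m)%N -> GRing.comm z (Fp k i)].
Proof.
move=> mn + zT; elim/ltn_ind: k => k IHk km.
have zS i j : (k <= i < m)%N -> (k <= j < m)%N ->
    GRing.comm z (\sum_(l < k) Fp l i * Dp l * Ep l j).
  move=> /andP[ki im] /andP[kj jm]; apply: commr_sum => l _.
  have lk := ltn_ord l.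
  have [zD zE zF] := IHk l lk (ltn_trans lk km).
  apply: commrM; first apply: commrM => //.
    by apply: zF => //; exact: leq_trans (ltnW lk) ki.
  by apply: zE => //; exact: leq_trans (ltnW lk) kj.
have zDE j : (k <= j < m)%N -> GRing.comm z (Dp k * Ep k j).
  move=> kjm; have /andP[kj jm] := kjm.
  have := gauss_row kj (leq_trans jm mn) => /eqP; rewrite addrC -subr_eq => /eqP <-.
  by apply: commrB; [apply: zT | apply: zS; rewrite ?leqnn ?km].
have zFD i : (k <= i < m)%N -> GRing.comm z (Fp k i * Dp k).
  move=> kim; have /andP[ki im] := kim.
  have := gauss_col ki (leq_trans im mn) => /eqP; rewrite addrC -subr_eq => /eqP <-.
  by apply: commrB; [apply: zT | apply: zS; rewrite ?leqnn ?km].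
have zD : GRing.comm z (Dp k) by have := zDE k; rewrite Epp mulr1; apply; rewrite leqnn.
have kn := leq_trans km mn.
split=> // [j kj jm|i ki im]; apply/eqP; rewrite -subr_eq0; apply/eqP.
  apply: (ps_lcancel (D0 kn)).
  by rewrite mulrBr mulrA -zD -mulrA [X in _ - X]mulrA -zDE ?kj // subrr.
apply: (ps_rcancel (D0 kn)); rewrite mulrBl -!mulrA zD zFD ?ki //.
by rewrite !mulrA subrr.
Qed.

Lemma gauss_centralize (z : A) k j m : (k < n)%N -> (j < n)%N ->
    (forall i l r, (i < n)%N -> (l < n)%N -> GRing.comm z (Tser T i l r)) ->
  GRing.comm z (D k m) /\ ((k < j)%N -> GRing.comm z (E k j m) /\ GRing.comm z (F k j m)).
Proof.
move=> kn jn zT.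
have [|zD zE zF] := @gauss_commute (psC z) n k (leqnn n) kn.
  by move=> i l i_n ln; apply/funext => r; rewrite psCM psMC; apply: zT.
have coef (f : pseries A) : GRing.comm (psC z) f -> GRing.comm z (f m).
  by move=> /(congr1 (@^~ m)); rewrite psCM psMC.
split=> [|kj]; first exact: coef.
by split; apply: coef; rewrite -?EpE -?FpE //; [apply: zE|apply: zF]; rewrite // ltnW.
Qed.

Hypothesis TP : yangian_rel n T.

(** Summands k < p have order at least 2 in u^{-1}, one from F and one from E; the summand k = p
    gives F times the constant term 1 of D. *)
Lemma T_subdiag p : (p.+1 < n)%N -> Tser T p.+1 p 1 = F p p.+1 1.
Proof.
move=> p1n; have pn := ltnW p1n.
have mul1 (f g : pseries A) : (f * g) 1%N = f 0%N * g 1%N + f 1%N * g 0%N.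
  by rewrite psM !big_ord_recl big_ord0 addr0.
have mul0 (f g : pseries A) : (f * g) 0%N = f 0%N * g 0%N by rewrite psM big_ord1.
rewrite -/(Tp p.+1 p) gauss_col // psD ps_sum big1 ?add0r => [|k _].
  by rewrite mul1 FpE // F0 // mul0r add0r /Dp D0 // mulr1.
have kp := ltn_ord k.
rewrite mul1 mul0 EpE // E0 // mulr0 addr0 FpE; last exact: ltnW.
by rewrite F0 //; [rewrite !mul0r | exact: ltnW].
Qed.

(** This is [T0_rel] at a = 0: the zeroth coefficients are Kronecker deltas, and l <= p kills the
    second product. *)
Let comm_subdiag p i l : (p.+1 < n)%N -> (i < n)%N -> (l <= p)%N ->
  comm (psC (F p p.+1 1)) (Tp i l) = if i == p then Tp p.+1 l else 0.
Proof.
move=> p1n i_n lp; have pn := ltnW p1n; have ln := leq_ltn_trans lp pn.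
apply/funext => m; rewrite ps_comm psCM psMC -T_subdiag //.
have TE k j r : (k < n)%N -> (j < n)%N -> Tser T k j r = T0 n T k j r.
  by rewrite /T0 => -> ->.
rewrite /Tp !TE // -/(comm _ _) -[LHS]subr0 -(comm_T0_0l n T p.+1 p (T0 n T i l m.+1)).
rewrite (T0_rel TP) -(TE i p 0%N) // -(TE p.+1 l 0%N) //= (gtn_eqF (_ : l < p.+1)%N) ?ltnS //.
by rewrite mulr0 subr0; case: eqP => [_|_]; rewrite ?mul1r ?TE // mul0r.
Qed.

(** X commutes with the leading block of T up to index i, hence with D_k and E_{k,i} for k <= i, and
    it carries T_{p,i} to T_{p+1,i}. Comparing Gauss expansions, the terms l < i agree by induction
    and D_i cancels. *)
Lemma F_comm i p : (i < p)%N -> (p.+1 < n)%N ->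
  F i p.+1 = comm (psC (F p p.+1 1)) (F i p : pseries A).
Proof.
move=> + p1n; elim/ltn_ind: i => i IHi ip; have pn := ltnW p1n.
have i_n := ltn_trans ip pn; set X := psC _.
have XDE k : (k <= i)%N -> GRing.comm X (Dp k) /\ GRing.comm X (Ep k i).
  move=> ki; have [||XD XE _] := @gauss_commute X i.+1 k i_n; rewrite ?ltnS //.
    move=> a l; rewrite !ltnS => ai li; apply: comm_comm.
    rewrite comm_subdiag ?(leq_ltn_trans ai) ?(leq_trans li) //; last exact: ltnW.
    by rewrite ltn_eqF // (leq_ltn_trans ai).
  by split=> //; apply: XE.
have comm_l f g : GRing.comm X g -> comm X (f * g) = comm X f * g.
  by move=> Xg; rewrite /comm mulrBl !mulrA -(mulrA f g) -Xg mulrA.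
have := comm_subdiag p1n pn (ltnW ip); rewrite eqxx.
rewrite (gauss_col (ltnW ip) pn) (gauss_col _ p1n) 1?ltnW ?ltnS 1?ltnW //.
rewrite commD (comm_l _ _ (XDE i (leqnn i)).1).
have -> : comm X (\sum_(l < i) Fp l p * Dp l * Ep l i)
    = \sum_(l < i) Fp l p.+1 * Dp l * Ep l i.
  rewrite (big_morph _ (commD X) (comm0 X)); apply: eq_bigr => l _.
  have li := ltn_ord l; have lp := ltn_trans li ip.
  have [XD XE] := XDE l (ltnW li).
  by rewrite (comm_l _ _ XE) (comm_l _ _ XD) (FpE lp) (FpE (ltnW lp : (l < p.+1)%N)) (IHi l li lp).
move/addrI/eqP; rewrite -subr_eq0 -mulrBl => /eqP /(ps_rcancel (D0 i_n)) /eqP.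
by rewrite subr_eq0 (FpE ip) (FpE (ltnW ip : (i < p.+1)%N)) => /eqP <-.
Qed.

End Gauss.

(** * Column operations *)

Section ColumnSpan.
Variables (L : nzRingType) (n : nat) (t : nat -> nat -> L).
Implicit Type v : nat -> L.

(** The coefficients stand on the right and do not depend on the row, the form that [Alt_col_span]
    takes. *)
Definition colspan k v :=
  exists a : nat -> L, forall i, (i < n)%N -> v i = \sum_(l < k) t i l * a l.

Lemma eq_colspan k v v' :
  (forall i, (i < n)%N -> v i = v' i) -> colspan k v -> colspan k v'.
Proof. by move=> ev [a va]; exists a => i i_n; rewrite -ev ?va. Qed.

Lemma colspanD k v v' : colspan k v -> colspan k v' -> colspan k (fun i => v i + v' i).
Proof.
move=> [a va] [a' va']; exists (fun l => a l + a' l) => i i_n.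
by rewrite va // va' // -big_split; apply: eq_bigr => l _; rewrite mulrDr.
Qed.

Lemma colspanMr k v x : colspan k v -> colspan k (fun i => v i * x).
Proof.
move=> [a va]; exists (fun l => a l * x) => i i_n.
by rewrite va // mulr_suml; apply: eq_bigr => l _; rewrite mulrA.
Qed.

Lemma colspanN k v : colspan k v -> colspan k (fun i => - v i).
Proof.
by move=> /(colspanMr (-1)); apply: eq_colspan => i _; rewrite mulrN1.
Qed.

Lemma colspan_sum k m (v : nat -> nat -> L) :
  (forall l, (l < m)%N -> colspan k (v l)) -> colspan k (fun i => \sum_(l < m) v l i).
Proof.
elim: m => [|m IHm] vk.
  exists (fun=> 0) => i i_n; rewrite big_ord0 big1 // => l _; exact: mulr0.
apply: (@eq_colspan _ (fun i => \sum_(l < m) v l i + v m i)) => [i _|].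
  by rewrite big_ord_recr.
by apply: colspanD; [apply: IHm => l lm; apply: vk; apply: ltnW | apply: vk].
Qed.

Lemma colspan_col k l : (l < k)%N -> colspan k (t^~ l).
Proof.
move=> lk; exists (fun j => (j == l)%:R) => i _.
rewrite (bigD1 (Ordinal lk)) //= eqxx mulr1 big1 ?addr0 // => j /negPf nj.
by rewrite -val_eqE /= in nj; rewrite nj mulr0.
Qed.

Lemma colspanW k m v : (m <= k)%N -> colspan m v -> colspan k v.
Proof.
move=> mk [a va]; apply: (@eq_colspan _ (fun i => \sum_(l < m) t i l * a l)) => [i i_n|].
  by rewrite va.
apply: (colspan_sum (v := fun l i => t i l * a l)) => l lm; apply: colspanMr.
by apply: colspan_col; apply: leq_trans mk.
Qed.

End ColumnSpan.

Section ColumnOperations.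
Variables (A : nzRingType) (n : nat) (T : nat -> nat -> nat -> A).
Variables (sg : nat -> nat -> nat).
Variables (D : nat -> nat -> A) (E F : nat -> nat -> nat -> A).
Hypothesis A2 : forall z : A, z + z = 0 -> z = 0.
Hypothesis TDEF : gauss_factorization n T D E F.
Hypothesis TP : yangian_rel n T.
Hypothesis sgU : forall i j, (i < n)%N -> (j < n)%N -> (j < i)%N -> sg i j = 0%N.

Lemma sigF_F i j : (i < j)%N -> (j < n)%N -> sigF sg F i j = F i j.
Proof.
elim: j => // j IHj; rewrite ltnS => ij jn; apply/funext => r /=.
case: eqVneq => [->//|nji]; have ltij : (i < j)%N by rewrite ltn_neqAle eq_sym nji.
rewrite ltij sgU ?(ltnW jn) // subn0 IHj ?(ltnW jn) //.
by rewrite (F_comm TDEF TP ltij jn) ps_comm psCM psMC.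
Qed.

Lemma sigFser_F k i : (k <= i)%N -> (i < n)%N -> sigFser sg F k i = tri_entry F k i.
Proof.
move=> ki i_n; rewrite /sigFser /tri_entry; case: eqVneq => // nki.
have lki : (k < i)%N by rewrite ltn_neqAle nki.
apply/funext => r; rewrite sgU //; last exact: ltn_trans i_n.
(* At r = 0 the cut-off gives 0, which agrees with the missing constant term of F. *)
case: r => [|r]; last by rewrite sigF_F.
by case: TDEF => _ [/(_ k i lki i_n) [_ ->]].
Qed.

Let Tp i j : pseries A := Tser T i j.

(** Entry (i, k) of F(u)D(u), zero above the diagonal. *)
Let FD k i : pseries A :=
  if (k <= i)%N then (tri_entry F k i : pseries A) * (D k : pseries A) else 0.

Let colsum i j (e : nat -> nat -> pseries A) : (i < n)%N -> (j < n)%N ->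
  \sum_(k < n | (k <= i)%N && (k <= j)%N)
    (tri_entry F k i : pseries A) * (D k : pseries A) * e k j
  = \sum_(k < j) FD k i * e k j + FD j i * e j j.
Proof.
move=> i_n jn.
transitivity (\sum_(k < n | (k < j.+1)%N) FD k i * e k j).
  rewrite [LHS]big_mkcond [RHS]big_mkcond; apply: eq_bigr => k _ /=.
  by rewrite ltnS /FD; case: leqP => //= _; case: ifP => //; rewrite mul0r.
by rewrite -(big_ord_widen n (fun k => FD k i * e k j)) // big_ord_recr.
Qed.

(** From T = (FD)E with E unitriangular, column k of FD is that of T minus right multiples of
    earlier columns of FD, which induction expresses through T. *)
Let FD_colspan k : (k < n)%N -> colspan n Tp k (fun i => FD k i - Tp i k).
Proof.
elim/ltn_ind: k => k IHk kn.
apply: (@eq_colspan _ _ _ _ (fun i =>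
    - (\sum_(l < k) FD l i * (tri_entry E l k : pseries A)))) => [i i_n|].
  have -> : Tp i k = \sum_(l < k) FD l i * (tri_entry E l k : pseries A) + FD k i.
    rewrite -[X in _ + X]mulr1 -(_ : tri_entry E k k = 1 :> pseries A).
      rewrite -(colsum (fun l k => tri_entry E l k)) //; apply/funext => m.
      by case: TDEF => _ [_ TE]; rewrite /Tp TE // ps_sum.
    by rewrite /tri_entry eqxx.
  by rewrite opprD addrC addrNK.
apply: colspanN; apply: (colspan_sum (v := fun l i => FD l i * (tri_entry E l k : pseries A))) => l lk.
apply: colspanMr; have ln := ltn_trans lk kn.
apply: (@eq_colspan _ _ _ _ (fun i => FD l i - Tp i l + Tp i l)) => [i _|].
  by rewrite subrK.
apply: colspanD; last exact: colspan_col.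
by apply: colspanW (IHk l lk ln); apply: ltnW.
Qed.

Let sigT_colspan j : (j < n)%N ->
  colspan n Tp j (fun i => (sigT n sg D E F i j : pseries A) - Tp i j).
Proof.
move=> jn; apply: (@eq_colspan _ _ _ _ (fun i =>
    \sum_(k < j) FD k i * (sigEser sg E k j : pseries A) + (FD j i - Tp i j))) => [i i_n|].
  rewrite addrA; congr (_ - _); apply/funext => m; rewrite /sigT.
  rewrite -[X in _ + X]mulr1 -(_ : sigEser sg E j j = 1 :> pseries A).
    rewrite -(colsum (fun l k => sigEser sg E l k)) // ps_sum.
    by apply: eq_bigr => k /andP[ki _]; rewrite sigFser_F.
  by rewrite /sigEser eqxx.
apply: colspanD; last exact: FD_colspan.
apply: (colspan_sum (v := fun k i => FD k i * (sigEser sg E k j : pseries A))) => k kj; apply: colspanMr.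
have kn := ltn_trans kj jn.
apply: (@eq_colspan _ _ _ _ (fun i => FD k i - Tp i k + Tp i k)) => [i _|].
  by rewrite subrK.
apply: colspanD; last exact: colspan_col.
by apply: colspanW (FD_colspan kn); apply: ltnW.
Qed.

Lemma C_nE : C_n n T = qdet n T.
Proof.
rewrite /C_n (eq_cdet (M' := fun i j => Ts n T j i j)) ?cdetE // => i j i_n jn.
by congr ps_shift; apply/funext => r; rewrite /T0 i_n jn.
Qed.

(** Shifting by j is multiplicative, so the relation of [sigT_colspan] for column j persists at u -
    j with shifted coefficients, and [Alt_col_span] applies. *)
Lemma sigma_C_nE : sigma_C_n n sg D E F = qdet n T.
Proof.
(* Rows beyond n are set to 0 because [Alt_col_span] asks for the relation at every row index. *)
pose S i j : nat -> A := ps_shift j (fun r => if (i < n)%N then sigT n sg D E F i j r else 0).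
rewrite /sigma_C_n (eq_cdet (M' := S)) => [|i j i_n jn]; last by rewrite /S i_n.
rewrite cdetE.
apply: (Alt_col_span (ps_2torsion_free A2) (@Ts_col _ _ _ TP) (S := fun j i => S i j)) => j jn.
have [a Ha] := sigT_colspan jn; exists (fun k => ps_shift j (a k)) => i.
have shM (f g : pseries A) : ps_shift j (f * g) = (ps_shift j f : pseries A) * ps_shift j g.
  exact: ps_shiftM.
rewrite /Ts (eq_bigr (fun k : 'I_j => (ps_shift j (T0 n T i k * a k) : pseries A)));
  last by move=> k _; rewrite shM.
have shD (f g : pseries A) : ps_shift j (f + g) = (ps_shift j f : pseries A) + ps_shift j g.
  by apply/funext => m; apply: ps_shiftD.
have sh0 : ps_shift j (0 : pseries A) = 0 :> pseries A.
  by apply: (addrI (ps_shift j (0 : pseries A) : pseries A)); rewrite -shD !addr0.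
rewrite -(big_morph (fun f : pseries A => ps_shift j f : pseries A) shD sh0) -shD.
congr (ps_shift j _); case: (ltnP i n) => [i_n|ni]; last first.
  rewrite big1 => [|k _]; apply/funext => r; rewrite ?psD /T0 ltnNge ni ?addr0 //=.
  by rewrite psM big1 // => l _; rewrite mul0r.
have T0E l : (l < n)%N -> T0 n T i l = Tp i l.
  by move=> ln; apply/funext => r; rewrite /T0 i_n ln.
have -> : \sum_(k < j) T0 n T i k * a k = \sum_(k < j) Tp i k * a k.
  by apply: eq_bigr => k _; rewrite T0E // (ltn_trans (ltn_ord k)).
by rewrite T0E // -[LHS](subrK (Tp i j)) Ha // [LHS]addrC.
Qed.

End ColumnOperations.

(** * The shifted Yangian *)

Section Subalgebra.
Variables (K : fieldType) (A : algType K) (S : A -> Prop).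
Local Notation G := (gen_subalg S).

Lemma gen_subalg0 : G 0.
Proof. by rewrite -(scale0r (1 : A)); apply: gsa_scale; apply: gsa_one. Qed.

Lemma gen_subalgN x : G x -> G (- x).
Proof. by rewrite -scaleN1r; apply: gsa_scale. Qed.

Lemma gen_subalg_comm x y : G x -> G y -> G (comm x y).
Proof. by move=> Gx Gy; apply: gsa_add; [|apply: gen_subalgN]; apply: gsa_mul. Qed.

Lemma gen_subalg_sum (I : Type) (r : seq I) (P : pred I) (f : I -> A) :
  (forall i, P i -> G (f i)) -> G (\sum_(i <- r | P i) f i).
Proof. by move=> Gf; elim/big_ind: _ => //; [exact: gen_subalg0 | exact: gsa_add]. Qed.

Lemma gen_subalg_ps1 m : G (ps1 A m).
Proof. by rewrite /ps1; case: eqP => _; [exact: gsa_one | exact: gen_subalg0]. Qed.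

Lemma gen_subalg_ps_mul (f g : nat -> A) :
  (forall m, G (f m)) -> (forall m, G (g m)) -> forall m, G (ps_mul f g m).
Proof. by move=> Gf Gg m; apply: gen_subalg_sum => k _; apply: gsa_mul. Qed.

Lemma gen_subalg_ps_shift c (f : nat -> A) :
  (forall m, G (f m)) -> forall m, G (ps_shift c f m).
Proof.
move=> Gf m; apply: gen_subalg_sum => k _.
by rewrite mulr_natr -scaler_nat; apply: gsa_scale.
Qed.

Lemma gen_subalg_cdet n (M : nat -> nat -> nat -> A) :
    (forall i j m, (i < n)%N -> (j < n)%N -> G (M i j m)) ->
  forall m, G (cdet n M m).
Proof.
move=> GM m; apply: gen_subalg_sum => w _.
have Gw : G (foldr (fun j acc => ps_mul (M (w j) j) acc) (@ps1 A) (enum 'I_n) m).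
  elim: (enum _) m => [|j r IHr] m /=; first exact: gen_subalg_ps1.
  by apply: gen_subalg_ps_mul => // k; apply: GM.
by case: (w : bool); rewrite ?expr0 ?expr1 ?mul1r ?mulN1r //; apply: gen_subalgN.
Qed.

End Subalgebra.

Lemma char0_2torsion_free (K : fieldType) (V : lmodType K) (z : V) :
  [pchar K] =i pred0 -> z + z = 0 -> z = 0.
Proof.
move=> K0 z0; have /eqP : (2%:R : K) *: z = 0 by rewrite scaler_nat mulr2n.
rewrite scaler_eq0 => /orP[two0|/eqP //].
by have := K0 2%N; rewrite !inE /= two0.
Qed.

Section ShiftedYangian.
Variables (K : fieldType) (A : algType K) (n : nat) (sg : nat -> nat -> nat).
Variables (D : nat -> nat -> A) (E F : nat -> nat -> nat -> A).
Hypothesis sgP : is_shift_matrix n sg.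
Hypothesis D0 : forall i, (i < n)%N -> D i 0%N = 1.

Local Notation G := (gen_subalg (shifted_gen n sg D E F)).

Lemma gen_subalg_sigE i j r :
  (i < j)%N -> (j < n)%N -> (sg i j < r)%N -> G (sigE sg E i j r).
Proof.
elim: j r => // j IHj r; rewrite ltnS => ij jn sr /=.
case: eqVneq => [eji|nji].
  by subst j; apply: gsa_gen; right; left; exists i, r.
have ltij : (i < j)%N by rewrite ltn_neqAle eq_sym nji.
rewrite ltij; apply: gen_subalg_comm.
  apply: IHj => //; first exact: ltnW.
  (* Additivity s_{i,j+1} = s_{i,j} + s_{j,j+1} keeps the lowered index above s_{i,j}. *)
  have := sgP (ltn_trans ltij (ltnW jn)) (ltnW jn) jn; rewrite /natdist => H.
  have {H} := H ltac:(lia); lia.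
by apply: gsa_gen; right; left; exists j, (sg j j.+1).+1.
Qed.

Lemma gen_subalg_sigF i j r :
  (i < j)%N -> (j < n)%N -> (sg j i < r)%N -> G (sigF sg F i j r).
Proof.
elim: j r => // j IHj r; rewrite ltnS => ij jn sr /=.
case: eqVneq => [eji|nji].
  by subst j; apply: gsa_gen; right; right; exists i, r.
have ltij : (i < j)%N by rewrite ltn_neqAle eq_sym nji.
rewrite ltij; apply: gen_subalg_comm; last first.
  apply: IHj => //; first exact: ltnW.
  have := sgP jn (ltnW jn) (ltn_trans ltij (ltnW jn)); rewrite /natdist => H.
  have {H} := H ltac:(lia); lia.
by apply: gsa_gen; right; right; exists j, (sg j.+1 j).+1.
Qed.

Lemma gen_subalg_sigma_C_n m : G (sigma_C_n n sg D E F m).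
Proof.
apply: gen_subalg_cdet => i j r i_n jn; apply: gen_subalg_ps_shift => {}r.
apply: gen_subalg_sum => k /andP[ki kj]; apply: gen_subalg_ps_mul => {}r.
  apply: gen_subalg_ps_mul => {}r.
    rewrite /sigFser; case: eqVneq => [_|nki]; first exact: gen_subalg_ps1.
    case: ifP => sr; last exact: gen_subalg0.
    by apply: gen_subalg_sigF => //; rewrite ltn_neqAle nki.
  case: r => [|r]; first by rewrite D0 //; apply: gsa_one.
  by apply: gsa_gen; left; exists k, r.+1.
rewrite /sigEser; case: eqVneq => [_|nkj]; first exact: gen_subalg_ps1.
case: ifP => sr; last exact: gen_subalg0.
by apply: gen_subalg_sigE => //; rewrite ltn_neqAle nkj.
Qed.

End ShiftedYangian.

Theorem theorem2p2 (K : closedFieldType) (A : algType K) (n : nat)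
    (sg : nat -> nat -> nat) (T : nat -> nat -> nat -> A)
    (D : nat -> nat -> A) (E F : nat -> nat -> nat -> A) :
  [pchar K] =i pred0 ->
  yangian_rel n T ->
  gauss_factorization n T D E F ->
  is_shift_matrix n sg ->
  (forall i j, (i < n)%N -> (j < n)%N -> (j < i)%N -> sg i j = 0%N) ->
  (forall m, sigma_C_n n sg D E F m = C_n n T m) /\
  (forall m,
     gen_subalg (shifted_gen n sg D E F) (sigma_C_n n sg D E F m) /\
     forall y, gen_subalg (shifted_gen n sg D E F) y ->
       sigma_C_n n sg D E F m * y = y * sigma_C_n n sg D E F m).
Proof.
move=> K0 TP TDEF sgP sgU.
have A2 (z : A) : z + z = 0 -> z = 0 by apply: char0_2torsion_free.
have sE := sigma_C_nE A2 TDEF TP sgU.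
split=> m; first by rewrite sE C_nE.
split; first by apply: gen_subalg_sigma_C_n => //; case: TDEF.
rewrite sE; set z := qdet n T m.
have zT i l r : (i < n)%N -> (l < n)%N -> GRing.comm z (Tser T i l r).
  move=> i_n ln; apply/commr_sym/comm_comm.
  by rewrite -(qdet_central TP A2 r m i_n ln) /T0 i_n ln.
(* Commuting with z is stable under the subalgebra operations; the generators are coefficients of
   Gauss factors, handled by [gauss_centralize]. *)
move=> y; elim=> {y} [y|||y x _ zy _ zx|y x _ zy _ zx].
- case=> [[i [r [i_n [_ ->]]]]|[[i [r [i_n [_ ->]]]]|[i [r [i_n [_ ->]]]]]].
  + by have [] := gauss_centralize TDEF (j := i) r i_n i_n zT.
  + by have [_ /(_ (ltnSn i)) []] := gauss_centralize TDEF r (ltnW i_n) i_n zT.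
  + by have [_ /(_ (ltnSn i)) []] := gauss_centralize TDEF r (ltnW i_n) i_n zT.
- by rewrite mulr1 mul1r.
- by move=> a y _ zy; rewrite -scalerAl -scalerAr zy.
- exact: commrD.
- exact: commrM.
Qed.
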